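(* Let $T$ be a tree on $n$ vertices such that $\operatorname{ppt}(T)=n-3$. Then $T=P_5$, or $T=P_6$, or $T=\mathrm{sp}(1,1,k)$ for some $k\geq 1$.
   Context: All graphs are finite and simple; equality of graphs means isomorphism. $P_n$ is the path on $n$ vertices. For $m\geq 3$ and positive integers $i_1,\ldots,i_m$, the spider $\mathrm{sp}(i_1,\ldots,i_m)$ is the tree obtained from the star $K_{1,m}$ with edges $e_1,\ldots,e_m$ by subdividing edge $e_j$ a total of $i_j-1$ times for $1\leq j\leq m$ (that is, a central vertex with $m$ legs, the $j$-th leg being a path on $i_j$ vertices with one endpoint attached to the center). For a graph $G$ and $S\subseteq V(G)$, let $N(v)$ be the set of neighbors of $v$ and $N[S]=S\cup\bigcup_{s\in S}N(s)$. Define $S^{[0]}=S$, $S^{[1]}=N[S]$, and for $t\geq 1$, $S^{[t+1]}=S^{[t]}\cup\{w\in V(G) : \exists\, v\in S^{[t]},\ N(v)\setminus S^{[t]}=\{w\}\}$. The set $S$ is a power dominating set of $G$ if $S^{[\ell]}=V(G)$ for some $\ell$; a minimum power dominating set is one of minimum cardinality. For a power dominating set $S$, $\operatorname{ppt}(G,S)$ is the smallest $\ell\ge 0$ with $S^{[\ell]}=V(G)$. The power propagation time of $G$ is $\operatorname{ppt}(G)=\min\{\operatorname{ppt}(G,S) : S \text{ is a minimum power dominating set of } G\}$. *)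

(* Defs.v *)
From mathcomp Require Import all_boot.

Set Implicit Arguments.
Unset Strict Implicit.
Unset Printing Implicit Defensive.

Record sgraph := SGraph {
  vertex :> finType;
  adj : rel vertex;
  adj_sym : symmetric adj;
  adj_irrefl : irreflexive adj
}.

Definition isomorphic (G H : sgraph) : Prop :=
  exists2 f : G -> H, bijective f & forall x y, adj (f x) (f y) = adj x y.

Definition connected (G : sgraph) : Prop := forall x y : G, connect (@adj G) x y.

(* A cycle is a cyclic sequence of at least three distinct vertices; the size
   bound excludes the sequences [:: x; y] along an edge and the empty one. *)
Definition acyclic (G : sgraph) : Prop :=
  forall c : seq G, 2 < size c -> ~ ucycle (@adj G) c.

Definition is_tree (G : sgraph) : Prop := [/\ 0 < #|G|, connected G & acyclic G].

Section Families.

Definition path_adj n : rel 'I_n := fun i j => (i.+1 == j) || (j.+1 == i).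

Lemma path_adj_sym n : symmetric (@path_adj n).
Proof. by move=> i j; rewrite /path_adj orbC. Qed.

Lemma path_adj_irrefl n : irreflexive (@path_adj n).
Proof. by move=> i; rewrite /path_adj orbb; apply: gtn_eqF. Qed.

Definition path_graph n : sgraph :=
  SGraph (@path_adj_sym n) (@path_adj_irrefl n).

(* [None] is the centre; [Some (Tagged _ a)] with tag [j] is the vertex at
   distance [a.+1] from the centre on the [j]-th leg, which has [legs`_j]
   vertices. *)
Definition spider_vertex (legs : seq nat) : finType :=
  option {j : 'I_(size legs) & 'I_(nth 0 legs j)}.

Definition spider_adj (legs : seq nat) : rel (spider_vertex legs) :=
  fun x y => match x, y with
  | None, None => false
  | None, Some q => (tagged q : nat) == 0
  | Some p, None => (tagged p : nat) == 0
  | Some p, Some q =>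
      (tag p == tag q) &&
      (((tagged p).+1 == tagged q :> nat) || ((tagged q).+1 == tagged p :> nat))
  end.

Lemma spider_adj_sym legs : symmetric (@spider_adj legs).
Proof. by move=> [p|] [q|] //=; rewrite eq_sym orbC. Qed.

Lemma spider_adj_irrefl legs : irreflexive (@spider_adj legs).
Proof. by move=> [p|] //=; rewrite eqxx orbb /=; apply: gtn_eqF. Qed.

Definition spider (legs : seq nat) : sgraph :=
  SGraph (@spider_adj_sym legs) (@spider_adj_irrefl legs).

End Families.

Section PowerDomination.

Variable G : sgraph.
Implicit Types (v w : G) (S X : {set G}) (l t : nat).

Definition nbr v : {set G} := [set w | adj v w].

Definition closed_nbr S : {set G} := S :|: \bigcup_(s in S) nbr s.

Definition force X : {set G} :=
  X :|: [set w | [exists v in X, nbr v :\: X == [set w]]].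

Fixpoint observed S t : {set G} :=
  match t with
  | 0 => S
  | 1 => closed_nbr S
  | t'.+1 => force (observed S t')
  end.

(* The bound on [l] only serves decidability, see [power_dominatingP]. *)
Definition power_dominating S : bool :=
  [exists l : 'I_#|G|.+2, observed S l == setT].

Lemma observedS S t : observed S t.+1 = iter t force (closed_nbr S).
Proof. by elim: t => //= t <-. Qed.

Lemma force_setT : force setT = setT.
Proof. by rewrite /force setTU. Qed.

Lemma force_stable X n :
  iter n force X = setT -> iter #|G| force X = setT.
Proof.
move=> XnT.
have [//|ge] : iter #|G| force X = setT \/ #|G| <= #|iter #|G| force X|.
  elim: #|G| => [|k [IH|IH]] /=; first by right.
    by left; rewrite IH force_setT.
  have sub : iter k force X \subset force (iter k force X) by apply: subsetUl.
  have [fix_k|neq] := eqVneq (iter k force X) (force (iter k force X)).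
    left; have [le_kn|/ltnW le_nk] := leqP k n.
      have stab m : iter (m + k) force X = iter k force X.
        by elim: m => //= m ->.
      by rewrite -fix_k -(stab (n - k)) subnK.
    rewrite -fix_k -(subnK le_nk) iterD XnT.
    by elim: (k - n) => //= m ->; rewrite force_setT.
  by right; apply: leq_ltn_trans IH _; apply: proper_card; rewrite properEneq neq.
by apply/eqP; rewrite eqEcard subsetT cardsT.
Qed.

Lemma power_dominatingP S :
  reflect (exists l, observed S l == setT) (power_dominating S).
Proof.
apply: (iffP existsP) => [[l Hl]|[[|l] Hl]]; first by exists l.
  by exists ord0.
exists ord_max; rewrite [X in observed _ X]/= observedS; apply/eqP.
by apply: (@force_stable _ l); rewrite -observedS; apply/eqP.
Qed.

Definition min_power_dominating S : bool :=
  power_dominating S &&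
  [forall S' : {set G}, power_dominating S' ==> (#|S| <= #|S'|)].

(* The value 0 outside power dominating sets is a dummy. *)
Definition ppt_of S : nat :=
  if power_dominatingP S is ReflectT ex_l then ex_minn ex_l else 0.

Lemma ex_ppt :
  exists l, [exists S, min_power_dominating S && (ppt_of S == l)].
Proof.
have pdT : power_dominating setT by apply/power_dominatingP; exists 0 => /=.
case: (arg_minnP (fun S : {set G} => #|S|) pdT) => S pdS minS.
exists (ppt_of S); apply/existsP; exists S; rewrite eqxx andbT.
by apply/andP; split=> //; apply/forallP=> S'; apply/implyP; apply: minS.
Qed.

Definition ppt : nat := ex_minn ex_ppt.

End PowerDomination.

(* Main.v *)
Require Import Defs.
From mathcomp Require Import all_boot zify.

Set Implicit Arguments.
Unset Strict Implicit.
Unset Printing Implicit Defensive.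

(** Each propagation step before the end observes at least one new vertex, so
    ppt(T) + |N[S]| <= n + 1 for every minimum power dominating set S
    ([ppt_of_bound]).  Thus ppt(T) = n - 3 forces |N[S]| <= 4 for all of them.

    A minimum power dominating set with at least two elements can always be
    chosen with |N[S]| >= 5 ([large_min_power_dominating]); this needs only
    connectedness.  Hence a minimum set is a single vertex v, of degree at
    most 3.

    In an acyclic graph the vertices observed from v form a connected set, so
    an unobserved vertex has at most one observed neighbour
    ([parent_unique]): propagation explores T as a tree rooted at v.  A vertex
    other than v forces only once, so it has at most one child, that is, degree
    at most 2 ([noncenter_degree]).

    If deg v = 3, then |N[v]| = 4 and ppt(T) = n - 3 leave exactly one new
    vertex per step.  Its forcer is the vertex observed one step earlier, since
    any other candidate would have forced it sooner ([slow_leg]).  So one leg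
    at v is a path that grows at every step, the two others are single
    vertices, and T = sp(1,1,k).

    If deg v <= 2, then all degrees are at most 2 and T is a path
    ([isomorphic_path]).  For n >= 7 the fourth vertex of the path reaches
    everything in n - 4 steps ([fast_path]), and for n <= 4 the equation
    ppt(T) = n - 3 <= 1 fails because one step observes at most three vertices;
    n = 5 and n = 6 remain. *)

(** * Observation and forcing *)

Section Observation.

Variable G : sgraph.
Implicit Types (u v w x y z : G) (S X Y : {set G}) (t : nat).

Lemma in_nbr v w : (w \in nbr v) = adj v w.
Proof. by rewrite inE. Qed.

Lemma closed_nbrP S x :
  reflect (x \in S \/ exists2 s, s \in S & adj s x) (x \in closed_nbr S).
Proof.
rewrite inE; apply: (iffP orP) => [[xS|/bigcupP[s sS]]|[xS|[s sS sx]]].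
- by left.
- by rewrite in_nbr => sx; right; exists s.
- by left.
- by right; apply/bigcupP; exists s; rewrite ?in_nbr.
Qed.

Lemma closed_nbr1P v x : reflect (x = v \/ adj v x) (x \in closed_nbr [set v]).
Proof.
apply: (iffP (closed_nbrP _ _)) => [[/set1P->|[s /set1P->]]|[->|vx]];
  try by [left | right].
- by left; rewrite inE.
- by right; exists v; rewrite ?inE.
Qed.

Lemma forceP X w :
  reflect (w \in X \/ exists2 v, v \in X & nbr v :\: X = [set w])
          (w \in force X).
Proof.
rewrite !inE; apply: (iffP orP) => -[wX|]; try by left.
- by case/existsP=> v /andP[vX /eqP vw]; right; exists v.
- by case=> v vX vw; right; apply/existsP; exists v; rewrite vX vw eqxx.
Qed.

Lemma mem_force X v w :
    v \in X -> adj v w -> (forall z, adj v z -> z \in X \/ z = w) ->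
  w \in force X.
Proof.
move=> vX vw onlyw; apply/forceP; have [|wX] := boolP (w \in X); first by left.
right; exists v => //; apply/setP=> z; rewrite in_setD in_nbr in_set1.
have [->|neq] := eqVneq z w; first by rewrite wX vw.
by apply/negP => /andP[/negP zX /onlyw[//|/eqP]]; rewrite (negPf neq).
Qed.

Lemma sub_force X : X \subset force X.
Proof. exact: subsetUl. Qed.

(** A vertex with w as only unobserved neighbour either still has it, or w
    is already observed. *)
Lemma force_mono X Y : X \subset Y -> force X \subset force Y.
Proof.
move=> sXY; apply/subsetP=> w /forceP[wX|[v vX vw]].
  by apply: (subsetP (sub_force _)); apply: (subsetP sXY).
have: w \in nbr v :\: X by rewrite vw set11.
rewrite in_setD in_nbr => /andP[_ adjvw].
apply: (@mem_force _ v) => [||z vz] //; first exact: (subsetP sXY).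
have [zX|zX] := boolP (z \in X); [by left; apply: (subsetP sXY)|right].
by apply/set1P; rewrite -vw in_setD zX in_nbr.
Qed.

Lemma iter_force_mono n X Y :
  X \subset Y -> iter n (@force G) X \subset iter n (@force G) Y.
Proof. by move=> sXY; elim: n => //= n; apply: force_mono. Qed.

Lemma sub_observedS S t : observed S t \subset observed S t.+1.
Proof. by case: t => [|t]; [apply: subsetUl | apply: sub_force]. Qed.

Lemma observed_mono S t t' : t <= t' -> observed S t \subset observed S t'.
Proof.
move/subnK <-; elim: (t' - t) => //= m IH.
exact: subset_trans IH (sub_observedS _ _).
Qed.

(** The first step is the only one in which a vertex observes all of its
    neighbours, hence the guard [0 < t]: with it, the domination step and the
    forcing steps are handled together, here and in [observedS_forcer]. *)
Lemma mem_observedS S t v w :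
    v \in observed S t -> adj v w ->
    (0 < t -> forall z, adj v z -> z \in observed S t \/ z = w) ->
  w \in observed S t.+1.
Proof.
case: t => [|t] vO vw onlyw; first by apply/closed_nbrP; right; exists v.
exact: mem_force vO vw (onlyw _).
Qed.

Lemma observedS_forcer S t w :
    w \in observed S t.+1 -> w \notin observed S t ->
  exists v, [/\ v \in observed S t, adj v w &
    0 < t -> forall z, adj v z -> z \in observed S t \/ z = w].
Proof.
case: t => [|t] wO1 /negP wO.
  by case/closed_nbrP: wO1 => // -[v vS vw]; exists v.
case/forceP: wO1 => // -[v vO vw]; exists v.
have: w \in nbr v :\: observed S t.+1 by rewrite vw set11.
rewrite in_setD in_nbr => /andP[_ adjvw]; split=> // _ z vz.
have [zX|zX] := boolP (z \in observed S t.+1); [by left|right].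
by apply/set1P; rewrite -vw in_setD zX in_nbr.
Qed.

(** The sequence is not the iteration of one map, because its first step is
    the closed neighbourhood; a set closed under neighbours is however also
    closed under forcing. *)
Lemma observed_stuck S t :
  observed S t.+1 = observed S t ->
  forall t', t <= t' -> observed S t' = observed S t.
Proof.
case: t => [|t] stuck t'; last first.
  move=> /subnK <-; elim: (t' - _) => // m; rewrite addSn addnS => IH.
  by rewrite -[LHS]/(force (observed S (m + t).+1)) IH.
move=> _; elim: t' => // -[|m] IH; rewrite ?stuck //.
rewrite -[LHS]/(force (observed S m.+1)) IH.
apply/eqP; rewrite eqEsubset sub_force andbT; apply/subsetP=> w.
case/forceP=> // -[v vS vw].
have: w \in nbr v :\: S by rewrite vw set11.
rewrite in_setD in_nbr => /andP[_ adjvw].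
have: w \in observed S 1 by apply/closed_nbrP; right; exists v.
by rewrite stuck.
Qed.

Lemma ppt_of_observed S : power_dominating S -> observed S (ppt_of S) = setT.
Proof.
rewrite /ppt_of; case: power_dominatingP => // ex_l _.
by case: ex_minnP => m /eqP.
Qed.

Lemma ppt_of_min S t : observed S t = setT -> ppt_of S <= t.
Proof.
move=> St; rewrite /ppt_of; case: power_dominatingP => // ex_l.
by case: ex_minnP => m _; apply; apply/eqP.
Qed.

Lemma ppt_min S : min_power_dominating S -> ppt G <= ppt_of S.
Proof.
move=> minS; rewrite /ppt; case: ex_minnP => m _; apply.
by apply/existsP; exists S; rewrite minS eqxx.
Qed.

Lemma ppt_attained : exists2 S : {set G}, min_power_dominating S & ppt_of S = ppt G.
Proof.
rewrite /ppt; case: ex_minnP => m /existsP[S /andP[minS /eqP Sm]] _.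
by exists S.
Qed.

Lemma observed_grows S t :
  power_dominating S -> t < ppt_of S -> #|observed S t| < #|observed S t.+1|.
Proof.
move=> pdS ltt; apply: proper_card; rewrite properEneq sub_observedS andbT.
apply/eqP=> stuck; suff: ppt_of S <= t by rewrite leqNgt ltt.
apply: ppt_of_min; rewrite -(ppt_of_observed pdS).
by rewrite [RHS](observed_stuck (esym stuck)) // ltnW.
Qed.

Lemma card_observed_growth S t t' :
    power_dominating S -> t <= t' <= ppt_of S ->
  #|observed S t| + (t' - t) <= #|observed S t'|.
Proof.
move=> pdS /andP[/subnK <-]; rewrite addnK; elim: (t' - t) => [|m IH] le_m.
  by rewrite addn0 add0n.
rewrite addnS addSn; apply: leq_ltn_trans (IH _) (observed_grows pdS _) => //.
exact: ltnW.
Qed.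

(** After the first step, |N[S]| vertices are observed and every later step
    adds at least one. *)
Lemma ppt_of_bound S :
  power_dominating S -> ppt_of S + #|closed_nbr S| <= #|G|.+1.
Proof.
move=> pdS; have [->|pos] := posnP (ppt_of S); first exact/leqW/max_card.
have := @card_observed_growth S 1 (ppt_of S) pdS; rewrite pos leqnn => /(_ isT).
rewrite (ppt_of_observed pdS) cardsT /=; lia.
Qed.

(** Propagation is monotone, so S' catches up with S once it has observed what
    S dominates; this is how one power dominating set is exchanged for
    another. *)
Lemma power_dominating_sub S S' n :
    closed_nbr S \subset iter n (@force G) (closed_nbr S') ->
  power_dominating S -> power_dominating S'.
Proof.
move=> sub /power_dominatingP[l /eqP Sl]; apply/power_dominatingP.
exists (l + n).+1; rewrite observedS iterD -subTset.
have: observed S l.+1 \subset iter l (@force G) (iter n (@force G) (closed_nbr S')).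
  by rewrite observedS iter_force_mono.
by apply: subset_trans; rewrite -Sl sub_observedS.
Qed.

Lemma min_power_dominating_leq S S' :
  min_power_dominating S -> power_dominating S' -> #|S| <= #|S'|.
Proof. by case/andP=> _ /forallP/(_ S')/implyP. Qed.

Lemma min_power_dominating_card S S' :
    min_power_dominating S -> power_dominating S' -> #|S'| <= #|S| ->
  min_power_dominating S'.
Proof.
move=> minS pdS' le; rewrite /min_power_dominating pdS'; apply/forallP=> X.
by apply/implyP=> /(min_power_dominating_leq minS); apply: leq_trans.
Qed.

Lemma connected_closed X x :
    connected G -> x \in X -> (forall y z, y \in X -> adj y z -> z \in X) ->
  forall y, y \in X.
Proof.
move=> conG xX closX y; have /connectP[p pth ->] := conG x y.
by elim: p x xX pth => //= z p IH x xX /andP[/(closX _ _ xX)]; apply: IH.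
Qed.

(** * Minimum power dominating sets with several vertices *)

Section LargeMinimum.

Variable S : {set G}.
Hypothesis minS : min_power_dominating S.

(** If s has a neighbour in S and at most one private neighbour, then S without
    s dominates s, which then forces that private neighbour: s was
    superfluous. *)
Lemma private_nbrs s s' :
    s \in S -> s' \in S -> adj s s' ->
  1 < #|nbr s :\: closed_nbr (S :\ s)|.
Proof.
move=> sS s'S ss'; rewrite ltnNge; apply/negP => le1.
suff pd: power_dominating (S :\ s).
  by have := min_power_dominating_leq minS pd; rewrite [in X in X -> _](cardsD1 s) sS ltnn.
case/andP: minS => pdS _; apply: (@power_dominating_sub S _ 1) pdS => /=.
have inS' z : z \in S -> z != s -> z \in S :\ s by rewrite !inE => -> ->.
have s'S' : s' \in S :\ s.
  by apply: inS' => //; apply/eqP=> s'E; rewrite s'E adj_irrefl in ss'.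
have sN : s \in closed_nbr (S :\ s).
  by apply/closed_nbrP; right; exists s'; rewrite // adj_sym.
apply/subsetP=> x /closed_nbrP[xS|[z zS zx]].
  have [->|xs] := eqVneq x s; apply: (subsetP (sub_force _)) => //.
  by apply/closed_nbrP; left; apply: inS'.
have [zs|zs] := eqVneq z s; last first.
  apply: (subsetP (sub_force _)); apply/closed_nbrP; right.
  by exists z => //; apply: inS'.
rewrite zs in zx; have [|xN] := boolP (x \in closed_nbr (S :\ s)).
  exact: (subsetP (sub_force _)).
apply: (mem_force sN zx) => y sy.
have [|yN] := boolP (y \in closed_nbr (S :\ s)); [by left|right].
have := card_le1_eqP le1 x y; rewrite !in_setD !in_nbr xN yN zx sy.
exact.
Qed.

(** The private neighbours of s and of s', two of each by [private_nbrs], are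
    distinct from one another and from s. *)
Lemma adjacent_large s s' :
  s \in S -> s' \in S -> adj s s' -> 4 < #|closed_nbr S|.
Proof.
move=> sS s'S ss'; have s's : adj s' s by rewrite adj_sym.
set A := nbr s :\: closed_nbr (S :\ s); set B := nbr s' :\: closed_nbr (S :\ s').
have cA : 1 < #|A| by apply: private_nbrs ss'.
have cB : 1 < #|B| by apply: private_nbrs s's.
have neq : s != s' by apply/eqP=> E; rewrite E adj_irrefl in ss'.
have dAB : A :&: B = set0.
  apply/setP=> x; rewrite inE in_set0; apply/negP => /andP[].
  rewrite !in_setD => /andP[/negP xN _] /andP[_]; rewrite in_nbr => s'x.
  apply: xN; apply/closed_nbrP; right; exists s' => //.
  by rewrite !inE eq_sym neq s'S.
have sAB : s \notin A :|: B.
  rewrite in_setU !in_setD !in_nbr adj_irrefl andbF /=; apply/negP => /andP[/negP sN _].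
  by apply: sN; apply/closed_nbrP; left; rewrite !inE neq sS.
have sub : s |: (A :|: B) \subset closed_nbr S.
  apply/subsetP=> x /setU1P[->|/setUP[]]; first by apply/closed_nbrP; left.
    by rewrite in_setD in_nbr => /andP[_ ?]; apply/closed_nbrP; right; exists s.
  by rewrite in_setD in_nbr => /andP[_ ?]; apply/closed_nbrP; right; exists s'.
have := subset_leq_card sub.
rewrite cardsU1 sAB cardsU dAB cards0 subn0 add1n.
by apply: leq_trans; rewrite ltnS (leq_add cA cB).
Qed.

End LargeMinimum.

(** Suppose that |N[S]| <= 4 for all minimum sets S.  By [adjacent_large] they
    are all independent, so N(s) lies in U = N[S] \ S for each s in S.  If U is
    a single vertex, or if one vertex of U is adjacent to two vertices of S,
    that vertex power dominates alone.  Otherwise S = {s, s'}, U = {u, u'}, s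
    is a leaf at u, and s' is a leaf at u'.  Then U is also a minimum set, so u
    and u' are not adjacent and {s, u} is a whole component. *)
Lemma large_min_power_dominating S :
    connected G -> min_power_dominating S -> 1 < #|S| ->
  exists2 S' : {set G}, min_power_dominating S' & 4 < #|closed_nbr S'|.
Proof.
move=> conG minS S_gt1.
case: (pickP (fun S' : {set G} => min_power_dominating S' && (4 < #|closed_nbr S'|))).
  by move=> S' /andP[]; exists S'.
move=> small; exfalso.
have {}small S' : min_power_dominating S' -> #|closed_nbr S'| <= 4.
  by move=> minS'; move: (small S'); rewrite minS' /= ltnNge => /negbFE.
have indep S' : min_power_dominating S' -> {in S' &, forall a b, ~~ adj a b}.
  move=> minS' a b aS bS; apply/negP=> ab.
  by have := adjacent_large minS' aS bS ab; rewrite ltnNge small.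
have pdS : power_dominating S by case/andP: minS.
have no1 z n : closed_nbr S \subset iter n (@force G) (closed_nbr [set z]) -> False.
  move=> /power_dominating_sub/(_ pdS)/(min_power_dominating_leq minS).
  by rewrite cards1 leqNgt S_gt1.
pose U := closed_nbr S :\: S.
have cardSUN : #|S| + #|U| = #|closed_nbr S|.
  rewrite /U cardsD; have /setIidPr-> : S \subset closed_nbr S by apply: subsetUl.
  by rewrite subnKC // subset_leq_card // subsetUl.
have cardSU : #|S| + #|U| <= 4 by rewrite cardSUN small.
have nbrU a b : a \in S -> adj a b -> b \in U.
  move=> aS ab; rewrite in_setD; apply/andP; split.
    by apply/negP=> bS; have := indep S minS a b aS bS; rewrite ab.
  by apply/closed_nbrP; right; exists a.
have [s [s' [sS s'S neq]]] := card_gt1P S_gt1.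
have hasnbr a : a \in S -> exists u, adj a u.
  move=> aS; apply/existsP; apply: contraT; rewrite negb_exists => /forallP iso.
  have all1 y : y \in [set a].
    apply: (connected_closed (x := a) conG) => [|b c /set1P-> ac]; first exact: set11.
    by have := iso c; rewrite ac.
  by move: neq; rewrite (set1P (all1 s)) (set1P (all1 s')) eqxx.
have [u su] := hasnbr s sS; have [u' su'] := hasnbr s' s'S.
have uU := nbrU _ _ sS su; have u'U := nbrU _ _ s'S su'.
have NSE x : x \in closed_nbr S -> x \in S \/ x \in U.
  by move=> xN; have [|xS] := boolP (x \in S); [left|right; rewrite in_setD xS].
have [U_le1|U_gt1] := leqP #|U| 1.
  have allu x : x \in U -> x = u by move=> xU; apply: (card_le1_eqP U_le1 u x).
  apply: (no1 u 0); apply/subsetP=> x /NSE[xS|/allu->]; apply/closed_nbr1P; last by left.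
  by have [y xy] := hasnbr x xS; right; rewrite -(allu y) 1?adj_sym //; apply: nbrU xy.
have [cardS cardU] : #|S| = 2 /\ #|U| = 2.
  by move: #|S| #|U| S_gt1 U_gt1 cardSU {cardSUN} => a b; clear; lia.
have SE : S = [set s; s'].
  apply/esym/eqP; rewrite eqEcard cards2 neq cardS andbT.
  by apply/subsetP=> x /set2P[]->.
(* A common neighbour z of s and s' power dominates alone: it observes both,
   and the other vertex of U is then forced by s or s'. *)
have nocommon z : adj s z -> adj s' z -> False.
  move=> sz s'z; apply: (no1 z 1); apply/subsetP=> x /NSE[xS|xU].
    apply: (subsetP (sub_force _)); apply/closed_nbr1P; right.
    by rewrite adj_sym; move: xS; rewrite SE => /set2P[]->.
  have [xN|xN] := boolP (x \in closed_nbr [set z]).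
    exact: (subsetP (sub_force _)).
  have zx : z != x by apply: contraNneq xN => <-; apply/closed_nbr1P; left.
  have zU := nbrU _ _ sS sz.
  have UE : U = [set z; x].
    apply/esym/eqP; rewrite eqEcard cards2 zx cardU andbT.
    by apply/subsetP=> y /set2P[]->.
  have [r rS rx] : exists2 r, r \in S & adj r x.
    by move: xU; rewrite in_setD => /andP[/negP xS /closed_nbrP[//|[r rS rx]]]; exists r.
  apply: (@mem_force _ r) => [||y ry] //.
    apply/closed_nbr1P; right; rewrite adj_sym.
    by move: rS; rewrite SE => /set2P[]->.
  have := nbrU _ _ rS ry; rewrite UE => /set2P[]->; last by right.
  by left; apply/closed_nbr1P; left.
have uu' : u != u' by apply/eqP=> E; apply: (nocommon u); rewrite // E.
have UE : U = [set u; u'].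
  apply/esym/eqP; rewrite eqEcard cards2 uu' cardU andbT.
  by apply/subsetP=> x /set2P[]->.
have Ns x : adj s x -> x = u.
  move=> sx; have := nbrU _ _ sS sx; rewrite UE => /set2P[//|xu'].
  by case: (nocommon u') => //; rewrite -xu'.
have Ns' x : adj s' x -> x = u'.
  move=> sx; have := nbrU _ _ s'S sx; rewrite UE => /set2P[xu|//].
  by case: (nocommon u) => //; rewrite -xu.
have subN : closed_nbr S \subset closed_nbr U.
  apply/subsetP=> x /NSE[|xU]; last by apply/closed_nbrP; left.
  rewrite SE => /set2P[]->; apply/closed_nbrP; right.
    by exists u; rewrite // adj_sym.
  by exists u'; rewrite // adj_sym.
have minU : min_power_dominating U.
  apply: (min_power_dominating_card minS); last by rewrite cardS cardU.
  exact: (@power_dominating_sub S _ 0) pdS.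
have NE : closed_nbr U = closed_nbr S.
  apply/esym/eqP; rewrite eqEcard subN (leq_trans (small _ minU)) //.
  by rewrite -cardSUN cardS cardU.
have: s' \in [set s; u].
  apply: (connected_closed (x := s) conG) => [|y z /set2P[]->]; first by rewrite set21.
    by move/Ns->; rewrite set22.
  move=> uz; have: z \in closed_nbr U by apply/closed_nbrP; right; exists u.
  rewrite NE => /NSE[|zU]; last by have := indep U minU u z uU zU; rewrite uz.
  rewrite SE => /set2P[->|zs']; first by rewrite set21.
  by case: (nocommon u su); rewrite adj_sym -zs'.
case/set2P=> [E|E]; first by rewrite E eqxx in neq.
by move: uU; rewrite in_setD -E s'S.
Qed.

End Observation.

(** * Propagation from one vertex of an acyclic graph *)

Section Tree.

Variable T : sgraph.
Hypothesis acyc : acyclic T.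
Implicit Types (u v w x y z : T) (t : nat).

Definition adj_avoiding x : rel T := [rel a b | [&& adj a b, a != x & b != x]].

(** A path from u to u' avoiding x closes up to a cycle through x. *)
Lemma nbrs_separated x u u' :
  adj x u -> adj x u' -> connect (adj_avoiding x) u u' -> u = u'.
Proof.
move=> xu xu' /connectP[p pth u'E]; apply/eqP; apply: contraT => neq; exfalso.
move: u'E neq xu'; case/shortenP: pth => q pth uniq_q _ -> neq xlast.
have q_gt0 : 0 < size q by case: q neq {pth uniq_q xlast} => //=; rewrite eqxx.
apply: (@acyc (x :: u :: q)) => //.
have adjq a s : path (adj_avoiding x) a s -> path (@adj T) a s.
  by elim: s a => //= b s IH a /andP[/and3P[-> _ _] /IH].
have notx a s : path (adj_avoiding x) a s -> x \notin s.
  elim: s a => //= b s IH a /andP[/and3P[_ _ bx] /IH xs].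
  by rewrite inE negb_or eq_sym bx.
apply/andP; split.
  by rewrite /= rcons_path xu adjq //= adj_sym.
rewrite cons_uniq uniq_q inE negb_or (notx _ _ pth) !andbT.
by apply/eqP=> E; rewrite E adj_irrefl in xu.
Qed.

Variable v : T.
Let O t := observed [set v] t.

Lemma observed_reach t x w :
  x \notin O t -> w \in O t -> connect (adj_avoiding x) v w.
Proof.
elim: t w => [|t IH] w xO wO; first by rewrite (set1P wO).
have xOt : x \notin O t by apply: contraNN xO; apply: (subsetP (sub_observedS _ _)).
have [/(IH _ xOt)//|wOt] := boolP (w \in O t).
have [f [fO fw _]] := observedS_forcer wO wOt.
apply: connect_trans (IH f xOt fO) (connect1 _); rewrite /adj_avoiding /= fw /=.
by apply/andP; split; apply: contraNneq xO => <- //; apply: (subsetP (sub_observedS _ _)).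
Qed.

(** Two observed neighbours of u would be joined by observed vertices, hence
    outside u.  The second one may even be observed in the same step as u,
    which excludes edges inside a level. *)
Lemma parent_unique t u f w :
    u \notin O t -> f \in O t -> adj u f -> w \in O t.+1 -> adj u w -> w = f.
Proof.
move=> uO fO uf wO uw; apply: (@nbrs_separated u) => //.
have symc : connect_sym (adj_avoiding u).
  apply: sym_connect_sym => a b; rewrite /adj_avoiding /= adj_sym.
  by congr (_ && _); rewrite andbC.
apply: connect_trans (observed_reach uO fO); rewrite symc.
have [/(observed_reach uO)//|wOt] := boolP (w \in O t).
have [g [gO gw _]] := observedS_forcer wO wOt.
apply: connect_trans (observed_reach uO gO) (connect1 _).
rewrite /adj_avoiding /= gw /=; apply/andP; split; first by apply: contraNneq uO => <-.
by apply/eqP=> E; rewrite E adj_irrefl in uw.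
Qed.

Hypothesis pdv : power_dominating [set v].

(** The truncated [t.-1] is harmless because [t = 0] is a separate case. *)
Lemma first_observed x : exists t, (x \in O t) && ((t == 0) || (x \notin O t.-1)).
Proof.
have ex : exists t, x \in O t.
  by exists (ppt_of [set v]); rewrite /O ppt_of_observed // inE.
exists (ex_minn ex); case: ex_minnP => t xO mint; rewrite xO /=.
by case: t xO mint => //= t xO mint; apply/negP=> /mint; rewrite ltnn.
Qed.

Lemma noncenter_degree u : u != v -> #|nbr u| <= 2.
Proof.
move=> uv; have [[|t] /andP[]] := first_observed u.
  by rewrite inE (negPf uv).
move=> uO1 /= uO; have [f [fO fu _]] := observedS_forcer uO1 uO.
have uf : adj u f by rewrite adj_sym.
rewrite (cardsD1 f) in_nbr uf ltnS leqNgt; apply/negP => /card_gt1P[w [w' []]].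
rewrite !in_setD1 !in_nbr => /andP[wf uw] /andP[w'f uw'] neq.
(* Besides the parent f, all neighbours of u are observed after u, and only u
   can force them; [clash] says that when one of them is observed, every other
   one has been observed before, so there cannot be two of them. *)
have late a s : adj u a -> a != f -> a \in O s -> t.+1 < s.
  move=> ua af aO; rewrite ltnNge; apply: contra_neqN af => les.
  apply: (parent_unique uO fO uf) => //.
  exact: (subsetP (observed_mono _ les)).
suff clash a b s : adj u a -> a != f -> adj u b -> a != b ->
    a \in O s.+1 -> a \notin O s -> b \in O s.
  have [[|s] /andP[wO]] := first_observed w; first by have := late _ _ uw wf wO.
  rewrite /= => wOs; have w'O := clash _ _ _ uw wf uw' neq wO wOs.
  have [[|s'] /andP[w'O']] := first_observed w'; first by have := late _ _ uw' w'f w'O'.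
  rewrite /= => w'Os'; have wO' : w \in O s' by apply: (clash w' w) => //; rewrite eq_sym.
  have : s' < s.
    by rewrite ltnNge; apply: contraNN w'Os' => le; apply: (subsetP (observed_mono _ le)).
  move/ltnW=> le; case/negP: wOs; exact: (subsetP (observed_mono _ le)).
move=> ua af ub ab aO1 aO; have lts := late _ _ ua af aO1.
have uOs : u \in O s by apply: (subsetP (observed_mono _ (_ : t.+1 <= s))).
have [g [gO ga only]] := observedS_forcer aO1 aO.
have gu : u = g.
  apply: (parent_unique aO gO); rewrite 1?adj_sym //.
  exact: (subsetP (sub_observedS _ _)).
have s_gt0 : 0 < s by by rewrite ltnS in lts; apply: leq_trans lts.
case: (only s_gt0 b); rewrite -?gu //.
by move=> E; rewrite E eqxx in ab.
Qed.

End Tree.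
(** * Trees of maximum degree two *)

Lemma isomorphic_of_inj (G H : sgraph) (g : H -> G) :
    injective g -> #|G| <= #|H| -> (forall x y, adj (g x) (g y) = adj x y) ->
  isomorphic G H.
Proof.
move=> inj_g le adj_g; have [h gK hK] := inj_card_bij inj_g le.
by exists h => [|x y]; [exists g | rewrite -adj_g !hK].
Qed.

Section Path.

Variable T : sgraph.
Hypotheses (conT : connected T) (acyc : acyclic T) (T_gt0 : 0 < #|T|).
Hypothesis deg2 : forall x : T, #|nbr x| <= 2.

Lemma maximal_path : exists2 s : seq T, uniq s && sorted (@adj T) s &
  0 < size s /\ forall s' : seq T, uniq s' && sorted (@adj T) s' -> size s' <= size s.
Proof.
pose P k := [exists p : k.-tuple T, uniq p && sorted (@adj T) p].
have PI (s : seq T) : uniq s && sorted (@adj T) s -> P (size s).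
  by move=> ok; apply/existsP; exists (in_tuple s).
have exP : exists k, P k by exists 0; apply: (PI [::]).
have ubP k : P k -> k <= #|T|.
  case/existsP=> p /andP[/card_uniqP card_p _].
  by rewrite -(size_tuple p) -card_p max_card.
case: (ex_maxnP exP ubP) => k /existsP[p ok] maxk; exists p => //.
rewrite size_tuple; split=> [|s' /PI/maxk//].
by have [x _] := card_gt0P T_gt0; apply: maxk (PI [:: x] _).
Qed.

Lemma path_no_chord x0 (s : seq T) i j :
    uniq s -> sorted (@adj T) s -> i.+1 < j -> j < size s ->
  ~~ adj (nth x0 s i) (nth x0 s j).
Proof.
move=> uniq_s sort_s ltij ltj; apply/negP=> chord.
pose c := drop i (take j.+1 s).
have size_c : size c = j.+1 - i by rewrite size_drop size_takel.
have nth_c m : m <= j - i -> nth x0 c m = nth x0 s (i + m).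
  by move=> le; rewrite nth_drop nth_take //; lia.
apply: (@acyc c); first by rewrite size_c; lia.
apply/andP; split; last by rewrite drop_uniq ?take_uniq.
have: sorted (@adj T) c by apply: drop_sorted; apply: take_sorted.
have := nth_c 0; have := nth_c (j - i); rewrite addn0 subnKC; last by lia.
case: c size_c {nth_c} => [|a c] /= size_c; first by lia.
move=> /(_ (leqnn _)) lastc /(_ isT) ac pth; rewrite rcons_path pth /=.
have lastE : last a c = nth x0 s j.
  rewrite -lastc -[last a c]/(last x0 (a :: c)) -nth_last /= .
  by congr nth; lia.
by rewrite lastE ac adj_sym.
Qed.

(** A longest path spans T: its ends have no neighbour outside it, as it could
    be extended otherwise, and its inner vertices already have their two
    neighbours on it. *)
Lemma spanning_path : exists2 s : seq T, uniq s /\ size s = #|T| &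
  forall x0 i j, i < size s -> j < size s ->
  adj (nth x0 s i) (nth x0 s j) = (i.+1 == j) || (j.+1 == i).
Proof.
have [s /andP[uniq_s sort_s] [s_gt0 maxs]] := maximal_path.
have step x0 i : i.+1 < size s -> adj (nth x0 s i) (nth x0 s i.+1).
  by move=> lti; apply: (sortedP x0 sort_s).
exists s; last first.
  move=> x0 i j.
  wlog ltij : i j / i < j => [IH lti ltj|lti ltj].
    case: (ltngtP i j) => ij; first exact: IH.
      by rewrite adj_sym orbC; apply: IH.
    by rewrite ij adj_irrefl; lia.
  have [<-|neq] := eqVneq i.+1 j; first by rewrite step //= ; lia.
  have lt2 : i.+1 < j by lia.
  by rewrite (negPf (path_no_chord x0 uniq_s sort_s lt2 ltj)) //; lia.
split=> //; rewrite -(card_uniqP uniq_s); apply/eq_card => y; rewrite [RHS]inE.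
case: s s_gt0 uniq_s sort_s maxs step => // x q _ uniq_s sort_s maxs step.
set s := x :: q in uniq_s sort_s maxs step *.
suff: y \in [set z in s] by rewrite inE.
apply: (connected_closed (x := x) conT) => [|z w]; first by rewrite !inE eqxx.
rewrite !in_set => zs zw; apply: contraT => ws.
have zE : nth x s (index z s) = z by apply: nth_index.
have ltz : index z s < size s by rewrite index_mem.
(* A new neighbour of an end of the path would extend it. *)
have z_gt0 : 0 < index z s.
  rewrite lt0n; apply/eqP=> i0; have := maxs (w :: s).
  rewrite cons_uniq ws uniq_s /= ltnn => ext; have // : false; apply: ext.
  by move: zE; rewrite i0 /= => xz; rewrite {1}xz adj_sym zw.
have z_lt : (index z s).+1 < size s.
  rewrite ltn_neqAle ltz andbT; apply/eqP=> iE; have := maxs (rcons s w).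
  rewrite rcons_uniq ws uniq_s size_rcons ltnn /= => ext; have // : false; apply: ext.
  rewrite rcons_path (sort_s : path _ x q) /=.
  by move: zE; rewrite -[index z s]/((index z s).+1.-1) iE nth_last /= => ->.
clearbody s; have := leq_trans _ (deg2 z); move=> /(_ 3) deg3; suff: 2 < 2 by [].
apply: deg3; pose a := nth x s (index z s).-1; pose b := nth x s (index z s).+1.
have ltp : (index z s).-1 < size s by apply: leq_ltn_trans (leq_pred _) ltz.
have ab : a != b.
  by rewrite nth_uniq //; case: (index z s) => //= i; rewrite ltn_eqF // ltnW.
have sub : [set w; a; b] \subset nbr z.
  apply/subsetP=> c; rewrite !inE -orbA => /or3P[]/eqP-> //.
    have := step x (index z s).-1; rewrite prednK // zE => /(_ ltz).
    by rewrite adj_sym.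
  by rewrite -[X in adj X _]zE step.
apply: leq_trans (subset_leq_card sub).
rewrite -setUA cardsU1 cards2 ab !inE negb_or.
have aw : w != a by apply: contraNneq ws => ->; apply: mem_nth.
by have -> : w != b by [apply: contraNneq ws => ->; apply: mem_nth]; rewrite aw.
Qed.

Lemma isomorphic_path : isomorphic T (path_graph #|T|).
Proof.
have [s [uniq_s size_s] adj_s] := spanning_path.
have [x0 _] := card_gt0P T_gt0.
apply: (@isomorphic_of_inj T (path_graph #|T|) (fun i => nth x0 s i)).
- move=> i j /eqP; rewrite nth_uniq ?size_s // => /eqP; exact: val_inj.
- by rewrite card_ord.
- by move=> i j; rewrite adj_s ?size_s.
Qed.

(** With the path numbered from 0, the vertices at distance at most t from the
    vertex 3 are observed at time t; if n >= 7, then n - 4 is the largest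
    distance from it.  Here v is any witness that one vertex suffices. *)
Lemma fast_path (v : T) :
    min_power_dominating [set v] -> 6 < #|T| -> ppt T + 4 <= #|T|.
Proof.
move=> minv big; have [s [uniq_s size_s] adj_s] := spanning_path.
pose c := nth v s 3.
have mem_s z : z \in s.
  suff: mem s =i mem T by move=> ->.
  by apply/subset_cardP; [rewrite (card_uniqP uniq_s) | apply/subsetP].
have reach t i : i < #|T| -> i <= 3 + t -> 3 <= i + t ->
    nth v s i \in observed [set c] t.
  elim: t i => [|t IH] i lti hi lo.
    by have -> : i = 3 by [lia]; rewrite inE.
  have [/andP[hi' lo']|new] := boolP ((i <= 3 + t) && (3 <= i + t)).
    by apply: (subsetP (sub_observedS _ _)); apply: IH.
  (* A vertex reached at time t.+1 is forced by its neighbour j on the side of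
     3, whose other neighbour k has been observed if t is positive. *)
  have onlyw j k : j < #|T| -> (j.+1 == i) && (k.+1 == j) || (i.+1 == j) && (j.+1 == k) ->
      j <= 3 + t -> 3 <= j + t -> (0 < t -> k <= 3 + t /\ 3 <= k + t) ->
      nth v s i \in observed [set c] t.+1.
    move=> ltj near hj lj hk; apply: (@mem_observedS _ _ _ (nth v s j)).
    - exact: IH.
    - rewrite adj_s ?size_s //; lia.
    move=> /hk[hik lok] z; rewrite -(nth_index v (mem_s z)).
    have ltz : index z s < #|T| by rewrite -size_s index_mem mem_s.
    rewrite adj_s ?size_s // => jz.
    have [->|zi] := eqVneq (index z s) i; [by right | left].
    by apply: IH => //; lia.
  have [gt3|le3] := ltnP 3 i; first by apply: (onlyw i.-1 i.-2); lia.
  by apply: (onlyw i.+1 i.+2); lia.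
have cover : observed [set c] (#|T| - 4) = setT.
  apply/setP=> z; rewrite inE.
  have ltz : index z s < #|T| by rewrite -size_s index_mem mem_s.
  by rewrite -(nth_index v (mem_s z)); apply: reach; lia.
have minc : min_power_dominating [set c].
  apply: (min_power_dominating_card minv); last by rewrite !cards1.
  by apply/power_dominatingP; exists (#|T| - 4); rewrite cover.
have := ppt_of_min cover; have := ppt_min minc; lia.
Qed.

End Path.

(** * Spiders with two short legs *)

Lemma card_closed_nbr1 (G : sgraph) (v : G) : #|closed_nbr [set v]| = #|nbr v|.+1.
Proof.
have -> : closed_nbr [set v] = v |: nbr v.
  apply/setP=> x; rewrite in_setU1 in_nbr.
  by apply/closed_nbr1P/orP => -[/eqP|]; [left|right|left|right].
by rewrite cardsU1 in_nbr adj_irrefl.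
Qed.

(** The edges i < j of sp(1,1,m) when 0 is the centre, 1 and 2 are the short
    legs and 3, 4, 5, and so on is the long one; [spider_pos] gives this
    numbering. *)
Definition spider_edge i j := (i == 0) && (0 < j <= 3) || (2 < i) && (j == i.+1).

Lemma spider_edge_lt i j : spider_edge i j -> i < j.
Proof. by case/orP=> /andP[]; [move/eqP-> => /andP[] | move=> _ /eqP->]. Qed.

Lemma spider_edge_geF i j : j <= i -> spider_edge i j = false.
Proof. by move=> le; apply/negP=> /spider_edge_lt; rewrite ltnNge le. Qed.

Definition spider_pos m (p : spider [:: 1; 1; m]) : nat :=
  if p is Some q then (if tag q < 2 then tag q : nat else (tagged q) + 2).+1 else 0.

Lemma spider_pos_lt m (p : spider [:: 1; 1; m]) : spider_pos p < m + 3.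
Proof.
case: p => [[[[|[|[|//]]] lt3] x]|] /=; rewrite ?addn3 //; have /= := ltn_ord x.
by rewrite addn2 !ltnS.
Qed.

Lemma spider_pos_inj m : injective (@spider_pos m).
Proof.
have ext (j j' : 'I_3) (x : 'I_(nth 0 [:: 1; 1; m] j))
    (x' : 'I_(nth 0 [:: 1; 1; m] j')) :
    j = j' :> nat -> x = x' :> nat ->
    existT (fun j : 'I_3 => 'I_(nth 0 [:: 1; 1; m] j)) j x = existT _ j' x'.
  by move=> /val_inj jj'; case: j' / jj' x' => x' /val_inj->.
move=> [[j x]|] [[j' x']|] posE //; congr Some; apply: ext; move: posE => /=;
  move: x x'; case: j j' => [[|[|[|//]]] ltj] [[|[|[|//]]] ltj'] /= x x';
  have /= := ltn_ord x; have /= := ltn_ord x'; lia.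
Qed.


Lemma spider_adjE m (p q : spider [:: 1; 1; m]) :
  adj p q = spider_edge (spider_pos p) (spider_pos q) ||
            spider_edge (spider_pos q) (spider_pos p).
Proof.
rewrite /spider_edge; case: p q => [[j x]|] [[j' x']|] //=.
- rewrite -val_eqE /=.
  case: j j' x x' => [[|[|[|//]]] ltj] [[|[|[|//]]] ltj'] /= x x';
    have /= := ltn_ord x; have /= := ltn_ord x'; lia.
- by case: j x => [[|[|[|//]]] ltj] /= x; have /= := ltn_ord x; lia.
- by case: j' x' => [[|[|[|//]]] ltj] /= x; have /= := ltn_ord x; lia.
Qed.


Lemma card_spider m : #|spider [:: 1; 1; m]| = m + 3.
Proof.
rewrite card_option card_tagged sumnE big_map big_enum /=.
rewrite !big_ord_recl big_ord0 /= !card_ord; lia.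
Qed.

Section Spider.

Variable T : sgraph.
Hypothesis acyc : acyclic T.
Variable v : T.
Hypothesis pdv : power_dominating [set v].
Hypothesis deg3 : #|nbr v| = 3.
Let O t := observed [set v] t.
Let k := ppt_of [set v].
Hypothesis slow : k + 3 = #|T|.

(** Four vertices are observed at time 1 and k + 3 at time k, with growth at
    every step in between. *)
Lemma slow_step i :
  0 < i < k -> exists x, [/\ x \notin O i, O i.+1 = x |: O i &
    exists f, [/\ f \in O i, adj f x &
      forall z, adj f z -> z \in O i \/ z = x]].
Proof.
move=> /andP[i_gt0 ltik].
have low : #|O 1| + (i - 1) <= #|O i| by apply: card_observed_growth; rewrite // i_gt0 ltnW.
have high : #|O i.+1| + (k - i.+1) <= #|O k|.
  by apply: card_observed_growth; rewrite ?leqnn ?andbT.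
have grow : #|O i| < #|O i.+1| by apply: observed_grows.
have c1 : #|O 1| = 4 by rewrite /O /= card_closed_nbr1 deg3.
have ck : #|O k| = #|T| by rewrite /O ppt_of_observed // cardsT.
have sub : O i \subset O i.+1 by apply: sub_observedS.
have /eqP/cards1P[x xE] : #|O i.+1 :\: O i| = 1.
  by rewrite cardsD (setIidPr sub); lia.
have: x \in O i.+1 :\: O i by rewrite xE set11.
rewrite in_setD => /andP[xO xO1]; exists x; split=> //.
  by rewrite -[LHS](setID _ (O i)) (setIidPr sub) xE setUC.
have [f [fO fx only]] := observedS_forcer xO1 xO.
by exists f; split=> // z; apply: only.
Qed.

(** [y i] is the vertex observed at time i; [y 1] is the neighbour of v that
    forces [y 2].  The forcer of [y i.+1] must be [y i].  If an older vertex
    forces [y i.+1], it is either adjacent to [y i], hence it is the parent of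
    [y i] and has two unobserved neighbours when it should force [y i]; or it is
    not, and then it could have forced [y i.+1] one step earlier. *)
Lemma slow_leg : exists y : nat -> T, adj v (y 1) /\
  forall i, 0 < i < k ->
    [/\ y i.+1 \notin O i, O i.+1 = y i.+1 |: O i & adj (y i) (y i.+1)].
Proof.
pose x i := odflt v [pick z in O i :\: O i.-1].
have xE i z : z \notin O i -> O i.+1 = z |: O i -> x i.+1 = z.
  move=> zO OE; rewrite /x OE; case: pickP => [w|/(_ z)] /=.
    by rewrite in_setD in_setU1 => /andP[/negPf->]; rewrite orbF => /eqP.
  by rewrite in_setD in_setU1 zO eqxx.
(* The forcer of the vertex observed at time 2 is not v, whose neighbours have
   all been observed at time 1; if k = 1, any neighbour of v will do. *)
have [y1 vy1 y1x] : exists2 y1, adj v y1 & 1 < k -> adj y1 (x 2).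
  have [lt1k|] := boolP (1 < k); last first.
    by have /card_gt0P[u] : 0 < #|nbr v| by [rewrite deg3]; rewrite in_nbr; exists u.
  have [z [zO OE [f [fO fz _]]]] := slow_step (lt1k : 0 < 1 < k).
  exists f; last by rewrite (xE 1 z).
  case/closed_nbr1P: fO => // fv; case/negP: zO.
  by apply/closed_nbr1P; right; rewrite -fv.
exists (fun i => if i == 1 then y1 else x i); split=> // -[//|i] ltik.
have [z [zO OE [f [fO fz only]]]] := slow_step ltik.
rewrite [i.+2 == 1]/= (xE _ _ zO OE); split=> //.
case: i => [|i] in ltik zO OE fO only *.
  by rewrite /= -(xE 1 z) //; apply: y1x.
have lti' : 0 < i.+1 < k by case/andP: ltik => _ /ltnW->.
have [z' [z'O OE' [g [gO gz' only']]]] := slow_step lti'.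
rewrite [i.+2 == 1]/= (xE _ _ z'O OE').
move: fO; rewrite OE' => /setU1P[<- //|fO]; exfalso.
have [fz'|nfz'] := boolP (adj f z').
  have z'O2 : z' \in O i.+2 by rewrite OE' setU11.
  have fg : f = g.
    apply: (parent_unique acyc z'O gO); rewrite 1?adj_sym //.
    by apply: (subsetP (sub_observedS _ _)).
  rewrite fg in fz; case/negP: zO; rewrite OE'.
  by case: (only' z fz) => [zO|->]; rewrite in_setU1 ?zO ?orbT ?eqxx.
case/negP: zO; apply: (mem_observedS fO fz) => _ w fw.
case: (only w fw); last by right.
rewrite OE' => /setU1P[wz'|]; last by left.
by rewrite -wz' fw in nfz'.
Qed.

Lemma slow_enum : exists z : nat -> T,
  forall i j, i < k + 3 -> j < k + 3 ->
  (z i = z j -> i = j) /\ adj (z i) (z j) = spider_edge i j || spider_edge j i.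
Proof.
have [y [vy1 y_spec]] := slow_leg.
have /cards2P[a [b [ab abE]]] : #|nbr v :\ y 1| == 2.
  by move: deg3; rewrite (cardsD1 (y 1)) in_nbr vy1 add1n => /eqP; rewrite eqSS.
have vaE u : u \in [set a; b] -> adj v u /\ u != y 1.
  by rewrite -abE in_setD1 in_nbr => /andP[].
have [va ay1] := vaE a (set21 _ _); have [vb by1] := vaE b (set22 _ _).
have neqv u : adj v u -> v != u.
  by move=> vu; apply: contraTneq vu => <-; rewrite adj_irrefl.
have nadj u w : adj v u -> adj v w -> adj u w = false.
  move=> vu vw; apply/negP=> uw; move: (neqv w vw).
  suff -> : w = v by rewrite eqxx.
  apply: (@parent_unique T acyc v 0 u) => //; rewrite 1?adj_sym //.
  - by rewrite in_set1 eq_sym neqv.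
  - exact: set11.
  - by apply/closed_nbr1P; right.
pose z i := match i with 0 => v | 1 => a | 2 => b | i.+3 => y i.+1 end.
have z_low i : i < 4 -> z i \in O 1.
  by case: i => [|[|[|[|//]]]] _; apply/closed_nbr1P; auto.
have z_obs i m : i < k + 3 -> i <= m.+3 -> z i \in O m.+1.
  move=> ltk ltm; have [lt4|] := ltnP i 4.
    exact: (subsetP (observed_mono _ _)) (z_low i lt4).
  case: i ltk ltm => [|[|[|[|i]]]] // ltk ltm _.
  have [|_ OE _] := y_spec i.+1; first by lia.
  have zO : z i.+4 \in O i.+2 by rewrite OE setU11.
  by apply: (subsetP (observed_mono _ _)) zO.
have adjv i : 0 < i < 4 -> adj v (z i) by case: i => [|[|[|[|//]]]].
exists z => i j.
have z_inj m n : m < n -> n < k + 3 -> z m != z n.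
  move=> ltmn ltn; have [lt4|] := ltnP n 4.
    case: m n ltmn lt4 {ltn} => [|m] n ltmn lt4; first by rewrite neqv // adjv ?ltmn.
    by case: n m ltmn lt4 => [|[|[|[|//]]]] [|[|[|//]]].
  case: n ltmn ltn => [|[|[|[|n]]]] // ltmn ltn _.
  have [|yO _ _] := y_spec n.+1; first by lia.
  by apply: contraNneq yO => E; rewrite -[y _]/(z n.+4) -E z_obs ?(ltn_trans ltmn).
have z_adj m n : m < n -> n < k + 3 -> adj (z m) (z n) = spider_edge m n.
  move=> ltmn ltn; rewrite /spider_edge; have [lt4|] := ltnP n 4.
    have [-> | m_gt0] := posnP m; first by rewrite /= adjv ?orbF; lia.
    rewrite nadj ?adjv //; lia.
  case: n ltmn ltn => [|[|[|[|n]]]] // ltmn ltn _.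
  have [|yO OE adjy] := y_spec n.+1; first by lia.
  have [->|neq] := eqVneq m n.+3; first by rewrite eqxx.
  rewrite eqSS [n.+3 == m]eq_sym (negPf neq) !andbF; apply/negP=> adjm.
  have ltm : m < n.+3 by rewrite ltn_neqAle neq -ltnS.
  suff yz : z m = z n.+3 by move: (z_inj m n.+3 ltm (ltnW ltn)); rewrite yz eqxx.
  apply: (parent_unique acyc yO); rewrite 1?adj_sym //.
    exact: (z_obs n.+3 n (ltnW ltn)).
  exact: (z_obs m n.+1 (ltn_trans ltmn ltn) (ltnW ltmn)).
move=> lti ltj; case: (ltngtP i j) => ij.
- split; first by move/eqP; rewrite (negPf (z_inj i j ij ltj)).
  by rewrite z_adj // (spider_edge_geF (ltnW ij)) orbF.
- split; first by move/esym/eqP; rewrite (negPf (z_inj j i ij lti)).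
  by rewrite adj_sym z_adj // (spider_edge_geF (ltnW ij)).
- by rewrite ij adj_irrefl spider_edge_geF.
Qed.

End Spider.

(** * The classification *)

Lemma isomorphic_spider (T : sgraph) (v : T) :
    acyclic T -> power_dominating [set v] -> #|nbr v| = 3 ->
    ppt_of [set v] + 3 = #|T| ->
  isomorphic T (spider [:: 1; 1; ppt_of [set v]]).
Proof.
move=> acyc pdv deg3 slow; have [z zP] := slow_enum acyc pdv deg3 slow.
apply: (@isomorphic_of_inj _ (spider _) (fun p => z (spider_pos p))).
- move=> p q /(zP _ _ (spider_pos_lt p) (spider_pos_lt q)).1.
  exact: spider_pos_inj.
- by rewrite card_spider slow.
- by move=> p q; rewrite (zP _ _ _ _).2 ?spider_pos_lt // spider_adjE.
Qed.

Lemma power_dominating_gt0 (G : sgraph) (S : {set G}) :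
  0 < #|G| -> power_dominating S -> 0 < #|S|.
Proof.
move=> /card_gt0P[x _] /power_dominatingP[l /eqP Sl]; rewrite lt0n; apply/eqP.
move/cards0_eq=> S0; have: x \in observed S l by rewrite Sl inE.
suff -> : observed S l = set0 by rewrite inE.
rewrite S0; elim: l {Sl} => // -[|l] IH.
  by rewrite /= /closed_nbr big_set0 setU0.
rewrite -[LHS]/(force (observed set0 l.+1)) IH; apply/setP=> w; rewrite [RHS]inE.
by apply/forceP => -[|[u]]; rewrite inE.
Qed.

(* The hypothesis is an equation between integers, so it is written without
   the truncated subtraction of nat. *)
Theorem proposition34 (T : sgraph) (n : nat) (treeT : is_tree T)
    (cardT : #|T| = n) (pptT : ppt T + 3 = n) :
  [\/ isomorphic T (path_graph 5),
      isomorphic T (path_graph 6) |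
      exists2 k : nat, 1 <= k & isomorphic T (spider [:: 1; 1; k])].
Proof.
case: treeT => T_gt0 conT acyc; rewrite -{n}cardT in pptT.
have small_nbr S : min_power_dominating S -> #|@closed_nbr T S| <= 4.
  move=> minS; have := ppt_min minS.
  by have [pdS _] := andP minS; have := ppt_of_bound pdS; lia.
have [S minS pptS] := ppt_attained T; have [pdS _] := andP minS.
have S_gt0 := power_dominating_gt0 T_gt0 pdS.
have S_le1 : #|S| <= 1.
  rewrite leqNgt; apply/negP=> /(large_min_power_dominating conT minS)[S' minS'].
  by rewrite ltnNge small_nbr.
have /eqP/cards1P[v Sv] : #|S| = 1 by lia.
rewrite {S}Sv in minS pptS pdS S_gt0 S_le1.
have deg_le3 := small_nbr _ minS; rewrite card_closed_nbr1 ltnS in deg_le3.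
have [deg3|deg_ne3] := eqVneq #|nbr v| 3.
  apply: Or33; exists (ppt_of [set v]).
    have := max_card (mem (closed_nbr [set v])).
    by rewrite card_closed_nbr1 deg3 pptS; lia.
  by apply: isomorphic_spider; rewrite // pptS.
have deg2 (x : T) : #|nbr x| <= 2.
  have [->|xv] := eqVneq x v; first by lia.
  exact: (noncenter_degree acyc pdS).
have lt7 : #|T| < 7.
  rewrite ltnNge; apply/negP=> ge7.
  by have := fast_path conT acyc T_gt0 deg2 minS ge7; lia.
have gt4 : 4 < #|T|.
  rewrite ltnNge; apply/negP=> le4; have pos : ppt T <= 1 by lia.
  have : #|observed [set v] 1| <= 3 by rewrite card_closed_nbr1 ltnS.
  have := ppt_of_observed pdS; rewrite pptS => cover.
  have := subset_leq_card (observed_mono [set v] pos).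
  rewrite cover cardsT => le_T le3.
  have ppt0 : ppt T = 0 by lia.
  move: cover; rewrite ppt0 /= => /(congr1 (fun X : {set T} => #|X|)).
  by rewrite cards1 cardsT; lia.
have := isomorphic_path conT acyc T_gt0 deg2.
by have [->|->] : #|T| = 5 \/ #|T| = 6 by [lia]; [apply: Or31|apply: Or32].
Qed.
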